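(* Let $X$ be a charming (Tychonoff) space that is not a $D$-space. Let $Y$ be a Lindelöf $\Sigma$ kernel of $X$, put $B=\overline{Y}^{\,X}$ (the closure of $Y$ in $X$), let $\mathsf{Obs}_{cc}(Y,B)$ be the set of all points $x\in B\setminus Y$ such that for every open neighborhood $U$ of $x$ in $X$ the subspace $U\cap Y$ is not countably compact, and let $H=\overline{\mathsf{Obs}_{cc}(Y,B)}^{\,B}$ (closure in $B$). Then no countable subset of $H\cap Y$ that is closed discrete in $H\cap Y$ is dense in $H$. Equivalently, $H$ is not the closure in $H$ of any countable closed discrete subset of $H\cap Y$.
   Context: All spaces are Tychonoff (completely regular and Hausdorff); subsets carry the subspace topology. A space $X$ is a $D$-space if for every neighborhood assignment $\varphi$ (a map assigning to each $x\in X$ an open set $\varphi(x)\ni x$) there is a closed discrete set $D\subseteq X$ with $X=\bigcup_{d\in D}\varphi(d)$. A space $Z$ is Lindelöf $\Sigma$ if there are a second countable Tychonoff space $M$ and a map $\Phi$ from $M$ to the nonempty compact subsets of $Z$ that is upper semicontinuous (for each open $U\subseteq Z$, $\{m\in M:\Phi(m)\subseteq U\}$ is open in $M$) with $Z=\bigcup_{m\in M}\Phi(m)$. A space $X$ is charming if it has a Lindelöf $\Sigma$ subspace $Y$ such that for every open $U\subseteq X$ with $Y\subseteq U$, the subspace $X\setminus U$ is Lindelöf $\Sigma$; such a $Y$ is called a Lindelöf $\Sigma$ kernel of $X$. Countably compact means every countable open cover has a finite subcover. *)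

(* Defs.v *)
From HB Require Import structures.
From mathcomp Require Import all_boot all_order all_algebra.
From mathcomp Require Import all_classical all_reals all_analysis.

Set Implicit Arguments.
Unset Strict Implicit.
Unset Printing Implicit Defensive.

Local Open Scope classical_set_scope.

(* A subset [A : set X], seen as a type (coercion [set_type]), carries the
   subspace topology; properties of spaces are stated for a [topologicalType]
   and are applied to subspaces through this coercion. *)

Definition tychonoff_space (X : topologicalType) : Prop :=
  completely_regular_space X /\ hausdorff_space X.

(* [S `&` A] as a subset of the subspace [A] *)
Definition trace_set (X : topologicalType) (A S : set X) : set A :=
  [set a : A | S (set_val a)].
Arguments trace_set {X} A S _.

(* the closure in the subspace [A], as a subset of the ambient space *)
Definition closure_in (X : topologicalType) (A S : set X) : set X :=
  set_val @` closure (trace_set A S).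

(* the subspace [D] is discrete *)
Definition discrete_set (X : topologicalType) (D : set X) : Prop :=
  forall x, D x -> isolated D x.

Definition closed_discrete (X : topologicalType) (D : set X) : Prop :=
  closed D /\ discrete_set D.

Definition D_space (X : topologicalType) : Prop :=
  forall phi : X -> set X, (forall x, open_nbhs x (phi x)) ->
  exists D : set X, closed_discrete D /\ \bigcup_(d in D) phi d = [set: X].

Definition usc_map (M Z : topologicalType) (Phi : M -> set Z) : Prop :=
  forall U : set Z, open U -> open [set m | Phi m `<=` U].

Definition lindelof_sigma (Z : topologicalType) : Prop :=
  exists (M : topologicalType) (Phi : M -> set Z),
    [/\ @second_countable M,
        tychonoff_space M,
        forall m, compact (Phi m) /\ Phi m !=set0,
        usc_map Phi
      & \bigcup_m Phi m = [set: Z] ].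

Definition lindelof_sigma_kernel (X : topologicalType) (Y : set X) : Prop :=
  lindelof_sigma Y /\
  forall U : set X, open U -> Y `<=` U -> lindelof_sigma (~` U).

Definition charming (X : topologicalType) : Prop :=
  exists Y : set X, lindelof_sigma_kernel Y.

Definition countably_compact (Z : topologicalType) : Prop :=
  forall C : set (set Z), countable C -> (forall V, C V -> open V) ->
    \bigcup_(V in C) V = [set: Z] ->
  exists C' : set (set Z),
    [/\ C' `<=` C, finite_set C' & \bigcup_(V in C') V = [set: Z] ].

Definition Obs_cc (X : topologicalType) (Y B : set X) : set X :=
  [set x | (B `\` Y) x /\
    forall U : set X, open U -> U x -> ~ countably_compact (U `&` Y)].

(* Main.v *)
(* If e belongs to a set E closed discrete in H ∩ Y and dense in H, then e is
   isolated in H, the closure of Obs, hence e lies in Obs, which misses Y; so E,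
   H and Obs are empty.  But Obs contains every x in B \ Y: by the Lindelöf
   property Y is covered by countably many open sets whose closures miss x, and
   if U ∩ Y were countably compact for a neighborhood U of x, finitely many would
   cover it, so that x would not lie in B.  Hence Y is closed.  Lindelöf Σ
   spaces are D-spaces (Buzyakova), so a closed discrete D1 ⊆ Y has a
   neighborhood φ(D1) ⊇ Y, and the complement of φ(D1) is a closed Lindelöf Σ
   subspace, which is handled by some D2: thus X is a D-space. *)

Require Import Defs.
From HB Require Import structures.
From mathcomp Require Import all_boot all_order all_algebra.
From mathcomp Require Import all_classical all_reals all_analysis.

Set Implicit Arguments.
Unset Strict Implicit.
Unset Printing Implicit Defensive.

Local Open Scope classical_set_scope.

(** * Closed discrete sets and their passage from subspaces *)

(** Closedness and discreteness merge into one local condition at every point: for [x] outside [D]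
    the set [V] misses [D], for [x] in [D] it isolates [x]. This form passes easily to unions and
    subspaces. *)
Lemma closed_discreteP (T : topologicalType) (D : set T) :
  closed_discrete D <->
  forall x : T, exists2 V : set T, nbhs x V & V `&` D `<=` [set x].
Proof.
split=> [[cD dD] x|DV].
  have [Dx|nDx] := pselect (D x).
    by have [_ [V xV VD]] := dD _ Dx; exists V => //; rewrite VD.
  exists (~` D); last by rewrite setICl.
  by apply: open_nbhs_nbhs; split => //; exact: closed_openC.
split=> [x Dx|x Dx].
  have [V xV VD] := DV x; have [y [Dy Vy]] := Dx _ xV.
  by rewrite -(VD y).
split; first exact/mem_set.
have [V xV VD] := DV x; exists V => //; apply/seteqP; split=> // _ ->.
by split=> //; exact: nbhs_singleton.
Qed.

Lemma closed_discreteU (T : topologicalType) (D D' : set T) :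
  closed_discrete D -> closed_discrete D' -> closed_discrete (D `|` D').
Proof.
move=> /closed_discreteP cD /closed_discreteP cD'; apply/closed_discreteP => x.
have [V xV VD] := cD x; have [V' xV' VD'] := cD' x.
exists (V `&` V'); first exact: filterI.
by move=> y [[Vy V'y] [Dy|D'y]]; [apply: VD|apply: VD'].
Qed.

Lemma locally_finite_closed_discrete (T : topologicalType) (D : set T) :
  accessible_space T ->
  (forall x : T, exists2 V : set T, nbhs x V & finite_set (V `&` D)) ->
  closed_discrete D.
Proof.
move=> T1 DV; apply/closed_discreteP => x; have [V xV finVD] := DV x.
(* Remove from [V] the finitely many points of [D] other than [x]; they form a closed set in a T1
   space. *)
exists (V `&` ~` ((V `&` D) `\ x)).
  apply: filterI => //; apply: open_nbhs_nbhs; split; last by case=> _; exact.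
  apply: closed_openC; apply: (accessible_finite_set_closed.1 T1).
  exact: finite_setD.
by move=> y [[Vy nVDy] Dy]; apply: contrapT => yx; apply: nVDy; split.
Qed.

Lemma nbhs_set_val (T : topologicalType) (A : set T) (x : A) (V : set A) :
  nbhs x V ->
  exists U : set T, [/\ open U, U (set_val x) & set_val @^-1` U `<=` V].
Proof.
by rewrite nbhsE => -[_ [[U oU <-] Ux] UV]; exists U; split.
Qed.

Lemma accessible_subspace (T : topologicalType) (A : set T) :
  accessible_space T -> accessible_space A.
Proof.
move=> T1 x y xy; have /T1[U [oU Ux Uy]] : set_val x != set_val y.
  by rewrite set_valE (inj_eq val_inj).
exists (set_val @^-1` U); split; first by exists U.
- by move/set_mem: Ux => Ux; exact/mem_set.
- by move/set_mem: Uy => Uy; exact/mem_set.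
Qed.

(** Closedness of [A] handles the points outside [A]: there the complement of [A] is a neighborhood
    free of [D]. *)
Lemma closed_discrete_set_val (T : topologicalType) (A : set T) (D : set A) :
  closed A -> closed_discrete D -> closed_discrete (set_val @` D).
Proof.
move=> cA /closed_discreteP cD; apply/closed_discreteP => x.
have [Ax|nAx] := pselect (A x); last first.
  exists (~` A).
    by apply: open_nbhs_nbhs; split=> //; exact: closed_openC.
  by move=> y [nAy [a _ ay]]; case: nAy; rewrite -ay; exact: set_valP.
have [V xV VD] := cD (exist _ x (mem_set Ax)).
have [U [oU Ux UV]] := nbhs_set_val xV.
exists U; first exact: open_nbhs_nbhs.
move=> y [Uy [a Da ay]]; move: Uy; rewrite -ay => Ua.
by rewrite (VD a) //; split=> //; exact: UV.
Qed.

(** * Finite subcovers and countable enumerations *)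

(** Compactness is used as near-covering along the filter of finite subsets of [A] directed by
    inclusion: near each point of [K] all large enough finite subsets cover, hence some finite
    subset covers all of [K]. *)
Lemma compact_finite_cover (T : topologicalType) (K A : set T)
    (phi : T -> set T) :
  compact K -> (forall a, A a -> open (phi a)) ->
  K `<=` \bigcup_(a in A) phi a ->
  exists B, [/\ finite_set B, B `<=` A & K `<=` \bigcup_(a in B) phi a].
Proof.
move=> /compact_near_coveringP cK ophi Kphi.
pose fin := [set B : set T | finite_set B /\ B `<=` A].
pose F := filter_from fin (fun B => [set C | B `<=` C /\ fin C]).
have FF : Filter F.
  apply: filter_from_filter; first by exists set0; split.
  move=> B B' [fB BA] [fB' BA']; exists (B `|` B').
    by split; [rewrite finite_setU|rewrite subUset].
  by move=> C [+ finC]; rewrite subUset => -[BC BC'].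
have [|B [fB BA] KB] := cK _ F (fun B x => (\bigcup_(a in B) phi a) x) FF.
  move=> x /Kphi[a Aa phix]; exists (phi a, [set C | [set a] `<=` C /\ fin C]).
    split=> /=; first by apply: open_nbhs_nbhs; split=> //; exact: ophi.
    by exists [set a] => //; split; [exact: finite_set1|move=> _ ->].
  by move=> [y C] /= [phiy [aC _]]; exists a => //; exact: aC.
by exists B; split=> //; apply: KB; split=> //; split.
Qed.

Lemma finite_sub_chain (T : choiceType) (D : nat -> set T) (B : set T) :
  (forall m n, (m <= n)%N -> D m `<=` D n) -> finite_set B ->
  B `<=` \bigcup_n D n -> exists n, B `<=` D n.
Proof.
move=> monoD /finite_seqP[s ->]; elim: s => [|x s IH] sD; first by exists 0%N.
have [|n sDn] := IH.
  by move=> y ys; apply: sD; rewrite /= inE ys orbT.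
have [|m _ Dmx] := sD x; first by rewrite /= inE eqxx.
exists (maxn m n) => y /=; rewrite inE => /orP[/eqP->|/sDn].
  exact: monoD (leq_maxl _ _) _ Dmx.
exact: monoD (leq_maxr _ _) _.
Qed.

Lemma countable_sub_range (T : Type) (A : set (set T)) :
  countable A -> exists s : nat -> set T, A `<=` range s.
Proof.
move=> /countable_injP[f finj].
(* By injectivity at most one member of [A] has code [k]. The union is that member, or empty if [k]
   is no code, so that [A] may be empty. *)
exists (fun k => \bigcup_(S in A `&` [set S | f S = k]) S) => S AS.
exists (f S) => //; apply/seteqP; split=> [x [S' [AS' /= fS']]|x Sx].
  by rewrite (finj S' S) ?inE.
by exists S.
Qed.

(** * Lindelöf Σ spaces: networks modulo compact sets and the D-property *)

(** The [N k] include the images under [Phi] of the members of a countable base of [M]; upper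
    semicontinuity makes them a network modulo the compact sets [Phi m]. *)
Lemma lindelof_sigma_network (Z : topologicalType) : lindelof_sigma Z ->
  exists (N : nat -> set Z), forall z, exists K, [/\ compact K, K z &
    forall U, open U -> K `<=` U -> exists2 k, N k z & N k `<=` U].
Proof.
move=> [M [Phi [[Bs cBs [oBs bBs]] _ cPhi uscPhi Phicov]]].
have [|N BN] := @countable_sub_range Z
  [set \bigcup_(m in b) Phi m | b in Bs].
  exact: card_le_trans (card_image_le _ _) _.
exists N => z; have [m _ zm] : (\bigcup_m Phi m) z by rewrite Phicov.
exists (Phi m); split=> [||U oU mU] //; first by case: (cPhi m).
have [b [Bb bm] bU] := bBs m _ (open_nbhs_nbhs (conj (uscPhi _ oU) mU)).
have [k _ Nk] := BN _ (ex_intro2 _ _ b Bb erefl).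
exists k; rewrite Nk; first by exists m.
by move=> y [m' /bU]; exact.
Qed.

(* The points d are chosen in stages.  At stage n, for every k <= n such that N k
   is covered by the current open set and finitely many phi x with x outside of
   it, such points x are added.  Later points avoid the open sets already
   reached, so the result is locally finite; if it missed z, then, by
   compactness, some N k containing z would have qualified and been covered. *)
Lemma lindelof_sigma_countable_D (Z : topologicalType)
    (phi : Z -> set Z) :
  accessible_space Z -> lindelof_sigma Z ->
  (forall x, open_nbhs x (phi x)) ->
  exists D : set Z,
    [/\ countable D, closed_discrete D & \bigcup_(d in D) phi d = [set: Z]].
Proof.
move=> T1 /lindelof_sigma_network[N NP] ophi.
pose st (B : set Z) := \bigcup_(b in B) phi b.
have open_st B : open (st B) by apply: bigcup_open => b _; case: (ophi b).
pose good (kU : nat * set Z) B :=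
  [/\ finite_set B, B `<=` ~` kU.2 & N kU.1 `<=` kU.2 `|` st B].
have /choice[G GP] kU : exists B, [/\ finite_set B, B `<=` ~` kU.2 &
    (exists B', good kU B') -> N kU.1 `<=` kU.2 `|` st B].
  have [[B [fB BU NB]]|no] := pselect (exists B', good kU B').
    by exists B.
  (* Default value when no good set exists: the last clause is then vacuous. *)
  by exists set0; split.
(* The bound [k <= n] keeps each stage finite, while every [k] is treated at all stages from [k]
   on. *)
pose next n D := D `|` \bigcup_(k in `I_n.+1) G (k, st D).
pose D := fix D n := if n is n'.+1 then next n' (D n') else set0.
have finD n : finite_set (D n).
  elim: n => //= n IH; rewrite finite_setU; split=> //.
  by apply: bigcup_finite => // k _; case: (GP (k, st (D n))).
have monoD m n : (m <= n)%N -> D m `<=` D n.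
  move=> /subnK <-; elim: (n - m)%N => // k IH x /IH Dx.
  by rewrite addSn; left.
have newD n m : D m `&` st (D n) `<=` D n.
  have [mn|/ltnW nm] := leqP m n; first by move=> x [/(monoD _ _ mn)].
  rewrite -(subnK nm); elim: (m - n)%N => [x []//|k IH x [] /=].
  move=> [Dx stx|[i _ Gx] stx]; first exact: IH.
  have [_ /(_ _ Gx) nst _] := GP (i, st (D (k + n)%N)).
  case: nst; case: stx => d Dd phidx; exists d => //.
  exact: monoD (leq_addl _ _) _ Dd.
pose Doo := \bigcup_n D n.
have covD : st Doo = [set: Z].
  apply/seteqP; split=> // z _; apply: contrapT => nz.
  have [K [cK Kz KU]] := NP z.
  have [|||B [fB BA KB]] := @compact_finite_cover _ K (Doo `|` ~` st Doo) phi.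
  - by [].
  - by move=> a _; case: (ophi a).
  - move=> x _; have [[d Dd phidx]|nx] := pselect (st Doo x).
      by exists d => //; left.
    by exists x; [right|case: (ophi x)].
  have [||n BDn] := @finite_sub_chain _ D (B `&` Doo) monoD.
  - exact: finite_setIl.
  - exact: subIsetr.
  pose B' := B `&` ~` st Doo.
  have KDB : K `<=` st (D n) `|` st B'.
    move=> x /KB[b Bb phibx]; have [Db|nDb] := BA _ Bb.
      by left; exists b => //; apply: BDn.
    by right; exists b.
  have [k Nkz NkU] := KU _ (openU (open_st _) (open_st _)) KDB.
  have sub_st p : (n <= p)%N -> st (D n) `<=` st (D p).
    by move=> np; apply: bigcup_subset; exact: monoD.
  (* At stage [p] the index [k] is treated since [k <= p], and [B'] witnesses that it qualifies:
     [B'] avoids [st (D p)], and [st (D p)] contains [st (D n)] since [n <= p]. *)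
  pose p := maxn k n.
  have [_ _ GPp] := GP (k, st (D p)).
  have /GPp /(_ z Nkz)[] : exists B0, good (k, st (D p)) B0.
  - exists B'; split; first exact: finite_setIl.
      by move=> x [_ nx] [d Dd phidx]; apply: nx; exists d => //; exists p.
    move=> x /NkU[stx|]; last by right.
    by left; exact: sub_st (leq_maxr _ _) _ stx.
  - by move=> [d Dd dz]; apply: nz; exists d => //; exists p.
  - move=> [d Gd dz]; apply: nz; exists d => //; exists p.+1 => //.
    by right; exists k => //=; rewrite ltnS leq_maxl.
exists Doo; split=> //.
  by apply: bigcup_countable => // n _; exact: finite_set_countable.
apply: locally_finite_closed_discrete => // x.
have [d [n _ Dnd] phidx] : st Doo x by rewrite covD.
exists (st (D n)); first by apply: open_nbhs_nbhs; split=> //; exists d.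
apply: sub_finite_set (finD n) => y [sty [m _ Dmy]].
exact: newD (conj Dmy sty).
Qed.

(** * Closed kernels, and points of the closure of a kernel outside it *)

Lemma closed_lindelof_sigma_cover (X : topologicalType) (A : set X)
    (phi : X -> set X) :
  accessible_space X -> closed A -> lindelof_sigma A ->
  (forall x, open_nbhs x (phi x)) ->
  exists D : set X, closed_discrete D /\ A `<=` \bigcup_(d in D) phi d.
Proof.
move=> T1 cA LA ophi.
have [||D [_ cD covD]] := @lindelof_sigma_countable_D A
    (fun a => set_val @^-1` phi (set_val a)) _ LA.
- exact: accessible_subspace.
- move=> a; have [oa pa] := ophi (set_val a).
  by split=> //; exists (phi (set_val a)).
exists (set_val @` D); split; first exact: closed_discrete_set_val.
move=> x Ax; pose a : A := exist _ x (mem_set Ax).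
have [d Dd dx] : (\bigcup_(d in D) (set_val @^-1` phi (set_val d))) a.
  by rewrite covD.
by exists (set_val d) => //; exists d.
Qed.

Lemma closed_kernel_D_space (X : topologicalType) (Y : set X) :
  accessible_space X -> lindelof_sigma_kernel Y -> closed Y -> D_space X.
Proof.
move=> T1 [LY kerY] cY phi ophi.
have [D1 [cD1 YD1]] := closed_lindelof_sigma_cover T1 cY LY ophi.
have oU : open (\bigcup_(d in D1) phi d).
  by apply: bigcup_open => d _; case: (ophi d).
have [D2 [cD2 UD2]] :=
  closed_lindelof_sigma_cover T1 (open_closedC oU) (kerY _ oU YD1) ophi.
exists (D1 `|` D2); split; first exact: closed_discreteU.
apply/seteqP; split=> // x _; rewrite bigcup_setU.
by have [|/UD2] := pselect ((\bigcup_(d in D1) phi d) x); [left|right].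
Qed.

Lemma Obs_cc_closureD (X : topologicalType) (Y : set X) :
  hausdorff_space X -> lindelof_sigma Y ->
  closure Y `\` Y `<=` Obs_cc Y (closure Y).
Proof.
move=> hX LY x [clx nYx]; split=> // U oU Ux ccU.
have /choice[W WP] (y : Y) : exists W : set X,
    [/\ open W, W (set_val y) & ~ closure W x].
  have xy : x != set_val y.
    by apply/eqP => xy; apply: nYx; rewrite xy; exact: set_valP.
  move: hX; rewrite open_hausdorff => /(_ _ _ xy)[[G W]] /= [].
  move=> /set_mem Gx /set_mem Wy [oG oW /eqP GW].
  exists W; split=> // clWx.
  have [z [Wz Gz]] := clWx _ (open_nbhs_nbhs (conj oG Gx)).
  by have : (G `&` W) z by []; rewrite GW.
(* Countability of [D] gives the Lindelöf property: countably many [W d] cover [Y]. *)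
have [||D [cD _ covD]] := @lindelof_sigma_countable_D Y
    (fun y => set_val @^-1` W y) _ LY.
- exact/accessible_subspace/hausdorff_accessible.
- by move=> y; have [oW Wy _] := WP y; split=> //; exists (W y).
have [|||C [CD fC covC]] := ccU
    ((fun d => set_val @^-1` W d : set (U `&` Y)) @` D).
- exact: card_le_trans (card_image_le _ _) _.
- by move=> _ [d _ <-]; exists (W d) => //; case: (WP d).
- apply/seteqP; split=> // z _; have [_ Yz] := set_valP z.
  have [d Dd dz] : (\bigcup_(d in D) (set_val @^-1` W d))
    (exist _ (set_val z) (mem_set Yz)) by rewrite covD.
  by exists (set_val @^-1` W d) => //; exists d.
(* A finite union of closures is closed, so [x], being in the closure of [U] ∩ [Y], lies in one of
   them, hence in some [closure (W d)]. *)
have clS : closed (\bigcup_(V in C) closure (set_val @` V)).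
  by apply: closed_bigcup => // V _; exact: closed_closure.
have /clS[V CV] : closure (\bigcup_(V in C) closure (set_val @` V)) x.
  move=> O xO; have [y [Yy [Oy Uy]]] :=
    clx _ (filterI xO (open_nbhs_nbhs (conj oU Ux))).
  have [V CV Vy] : (\bigcup_(V in C) V)
    (exist _ y (mem_set (conj Uy Yy)) : (U `&` Y : set X)) by rewrite covC.
  exists y; split=> //; exists V => //; apply: subset_closure.
  by eexists; first exact: Vy.
have [d _ <-] := CD _ CV; have [_ _ nWx] := WP d.
move=> clVx; apply: nWx; move: x clVx {clx nYx Ux WP clS}.
by apply: closureS => _ [z Wz <-].
Qed.

Theorem proposition3p40 (X : topologicalType) (hT : tychonoff_space X)
  (hX : charming X) (hD : ~ D_space X)
  (Y : set X) (hY : lindelof_sigma_kernel Y) :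
  let B := closure Y in
  let H := closure_in B (Obs_cc Y B) in
  (forall E : set X, E `<=` H `&` Y -> countable E ->
     closed_discrete (trace_set (H `&` Y) E) ->
     ~ dense (trace_set H E)) /\
  (forall E : set X, E `<=` H `&` Y -> countable E ->
     closed_discrete (trace_set (H `&` Y) E) ->
     H <> closure_in H E).
Proof.
move=> B H.
have ObsH : Obs_cc Y B `<=` H.
  move=> x Ox; have Bx : B x by case: Ox => -[].
  by exists (exist _ x (mem_set Bx)) => //; apply: subset_closure.
have HObs : H `<=` closure (Obs_cc Y B).
  move=> _ [b clb <-] O /= bO.
  have [|a [Obsa Oa]] := clb (set_val @^-1` O).
    exact: (@initial_continuous B X set_val).
  by exists (set_val a).
have main (E : set X) : E `<=` H `&` Y ->
    closed_discrete (trace_set (H `&` Y) E) -> ~ dense (trace_set H E).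
  move=> EHY /closed_discreteP cdE dE.
  have [hX' T1] : hausdorff_space X /\ accessible_space X.
    by case: hT => _ h; split=> //; exact: hausdorff_accessible.
  have dH (O : set X) h : open O -> H h -> O h -> exists2 e, E e & O e.
    move=> oO Hh Oh; have [||a [Oa Ea]] := dE (set_val @^-1` O).
    - by exists (exist _ h (mem_set Hh)).
    - by exists O.
    - by exists (set_val a).
  have E0 e : ~ E e.
    move=> Ee; have [He Ye] := EHY _ Ee.
    have [V eV VE] := cdE (exist _ e (mem_set (EHY _ Ee))).
    have [G [oG Ge GV]] := nbhs_set_val eV.
    have [h [Obsh Gh]] := HObs _ He _ (open_nbhs_nbhs (conj oG Ge)).
    (* Since [h] is outside [Y], it differs from [e]. Density then gives a point [f] of [E] in [G]
       other than [e], which [V] forbids. *)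
    have [||f Ef [Gf]] := dH (G `\ e) h _ (ObsH _ Obsh).
    - rewrite setDE; apply: openI => //; apply: closed_openC.
      exact: accessible_closed_set1.
    - by split=> // he; case: Obsh => -[_]; rewrite he.
    apply; pose f' : (H `&` Y : set X) := exist _ f (mem_set (EHY _ Ef)).
    by have /(congr1 set_val) := VE f' (conj (GV f' Gf) Ef).
  apply: hD; apply: (closed_kernel_D_space T1 hY) => x clx.
  apply: contrapT => nYx.
  have /ObsH Hx := @Obs_cc_closureD _ _ hX' hY.1 x (conj clx nYx).
  (* The point [x] of [H] forces the dense set [E] to be nonempty, against [E0]. *)
  by have [] := dH setT x openT Hx => // e /E0.
split=> E EHY _ cdE; first exact: main.
(* If [H] is the closure of [E] in [H], then every nonempty open subset of [H] meets [E], so [E] is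
   dense. *)
move=> HE; apply: (main E EHY cdE) => U [h Uh] [G oG GU].
have [a cla ah] : closure_in H E (set_val h) by rewrite -HE; exact: set_valP.
have [|c [Ec Gc]] := cla (set_val @^-1` G).
  apply: open_nbhs_nbhs; split; first by exists G.
  by rewrite /preimage /= ah; rewrite -GU in Uh.
by exists c; split=> //; rewrite -GU.
Qed.
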